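(* Let $n\ge 3$ be an integer. Then $BS(1,n)$ has a positive density of elements $g$ with $\kappa_1(g)>0$; that is, there is a set $\mathcal{A}\subset BS(1,n)$ of positive density in $BS(1,n)$ such that $\kappa_1(g)>0$ for every $g\in\mathcal{A}$.
   Context: $BS(1,n)=\langle t,a \mid tat^{-1}=a^n\rangle$. Word length $l(\cdot)$ is always with respect to the generating set $\{a,t\}$ (i.e. letters $a^{\pm1},t^{\pm1}$). $S_n(r)$ denotes the sphere of radius $r$ centered at the identity in $BS(1,n)$, i.e. the set of elements of word length exactly $r$. For $g\ne e$ and an integer $r\ge 1$, the conjugation curvature is $$\kappa_r(g)=\frac{l(g)-\frac{1}{|S_n(r)|}\sum_{p\in S_n(r)} l(p^{-1}gp)}{l(g)}.$$ For $\mathcal{A}\subset BS(1,n)$ let $\mathcal{A}(N)$ be the set of elements of $\mathcal{A}$ of word length $N$. The set $\mathcal{A}$ has positive density in $BS(1,n)$ if there is $\epsilon>0$ such that for all sufficiently large $N$, $\epsilon<\frac{|\mathcal{A}(N)|}{|S_n(N)|}<1-\epsilon$. *)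

(* Defs.v *)
From HB Require Import structures.
From mathcomp Require Import all_boot all_order all_algebra.
From mathcomp Require Import finmap all_classical reals.

Set Implicit Arguments.
Unset Strict Implicit.
Unset Printing Implicit Defensive.

Import Order.TTheory GRing.Theory Num.Theory.

Local Open Scope quotient_scope.
Local Open Scope classical_set_scope.

(* The letter (x, e) is the generator t if x = true and a if x = false, raised
   to the power -1 if e = true and 1 if e = false. *)
Definition letter : Type := (bool * bool)%type.
Definition word : Type := seq letter.

HB.instance Definition _ := Choice.on word.

Definition letter_a : letter := (false, false).
Definition letter_aV : letter := (false, true).
Definition letter_t : letter := (true, false).
Definition letter_tV : letter := (true, true).

Definition letter_inv (x : letter) : letter := (x.1, ~~ x.2).
Definition word_inv (u : word) : word := rev (map letter_inv u).

(* Two words represent the same element of < t, a | t a t^-1 = a^n >. *)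
Inductive bs_eq (n : nat) : word -> word -> Prop :=
| bs_eq_refl u : bs_eq n u u
| bs_eq_sym u v : bs_eq n u v -> bs_eq n v u
| bs_eq_trans u v w : bs_eq n u v -> bs_eq n v w -> bs_eq n u w
| bs_eq_cat u u' v v' :
    bs_eq n u u' -> bs_eq n v v' -> bs_eq n (u ++ v) (u' ++ v')
| bs_eq_cancel x : bs_eq n [:: x; letter_inv x] [::]
| bs_eq_relator :
    bs_eq n [:: letter_t; letter_a; letter_tV] (nseq n letter_a).

Lemma letter_invK : involutive letter_inv.
Proof. by case=> x e; rewrite /letter_inv /= negbK. Qed.

Lemma word_invK : involutive word_inv.
Proof.
move=> u; rewrite /word_inv map_rev revK -map_comp.
by rewrite (eq_map (g := id)) ?map_id // => x /=; rewrite letter_invK.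
Qed.

Lemma bs_eq_mulwV n u : bs_eq n (u ++ word_inv u) [::].
Proof.
elim: u => [|x u IH]; first exact: bs_eq_refl.
rewrite /word_inv /= rev_cons -cats1 -cat1s catA.
apply: (bs_eq_trans (v := [:: x] ++ [:: letter_inv x])); last exact: bs_eq_cancel.
rewrite -catA; apply: bs_eq_cat; first exact: bs_eq_refl.
rewrite -[X in bs_eq _ _ X]cat0s catA; apply: bs_eq_cat => //.
exact: bs_eq_refl.
Qed.

Lemma bs_eq_mulVw n u : bs_eq n (word_inv u ++ u) [::].
Proof. by rewrite -{2}[u]word_invK; exact: bs_eq_mulwV. Qed.

Lemma bs_eq_inv n u v : bs_eq n u v -> bs_eq n (word_inv u) (word_inv v).
Proof.
move=> uv; apply: (bs_eq_trans (v := word_inv u ++ (v ++ word_inv v))).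
  rewrite -{1}[word_inv u]cats0; apply: bs_eq_cat; first exact: bs_eq_refl.
  exact/bs_eq_sym/bs_eq_mulwV.
rewrite catA -[X in bs_eq _ _ X]cat0s; apply: bs_eq_cat; last exact: bs_eq_refl.
apply: bs_eq_trans (bs_eq_mulVw n u).
by apply: bs_eq_cat; [exact: bs_eq_refl | exact: bs_eq_sym].
Qed.

Definition bs_eqb (n : nat) : rel word := fun u v => `[< bs_eq n u v >].

Lemma bs_eqb_refl n : reflexive (bs_eqb n).
Proof. by move=> u; apply/asboolP; exact: bs_eq_refl. Qed.

Lemma bs_eqb_sym n : symmetric (bs_eqb n).
Proof. by move=> u v; apply/asboolP/asboolP; exact: bs_eq_sym. Qed.

Lemma bs_eqb_trans n : transitive (bs_eqb n).
Proof.
by move=> v u w /asboolP uv /asboolP vw; apply/asboolP; exact: bs_eq_trans vw.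
Qed.

Canonical bs_equiv (n : nat) :=
  EquivRel (bs_eqb n) (@bs_eqb_refl n) (@bs_eqb_sym n) (@bs_eqb_trans n).

Definition BS (n : nat) : Type := {eq_quot bs_equiv n}.

HB.instance Definition _ n := Choice.on (BS n).
HB.instance Definition _ n := EqQuotient.on (BS n).

Definition bs_class (n : nat) (u : word) : BS n := \pi_(BS n) u.

Lemma bs_classP n u v : bs_class n u = bs_class n v <-> bs_eq n u v.
Proof.
split=> [/eqmodP /asboolP //|uv].
by apply/eqmodP/asboolP.
Qed.

Lemma bs_class_repr n (g : BS n) : bs_class n (repr g) = g.
Proof. exact: reprK. Qed.

Definition bs_one n : BS n := bs_class n [::].
Definition bs_mul n (g h : BS n) : BS n := bs_class n (repr g ++ repr h).
Definition bs_inv n (g : BS n) : BS n := bs_class n (word_inv (repr g)).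

Lemma bs_eq_repr n u : bs_eq n (repr (bs_class n u)) u.
Proof. by apply/bs_classP; rewrite bs_class_repr. Qed.

Lemma bs_mul_class n u v :
  bs_mul (bs_class n u) (bs_class n v) = bs_class n (u ++ v).
Proof. by apply/bs_classP; apply: bs_eq_cat; exact: bs_eq_repr. Qed.

Lemma bs_inv_class n u : bs_inv (bs_class n u) = bs_class n (word_inv u).
Proof. by apply/bs_classP/bs_eq_inv/bs_eq_repr. Qed.

Lemma bs_mulA n : associative (@bs_mul n).
Proof.
move=> x y z; rewrite -(bs_class_repr x) -(bs_class_repr y) -(bs_class_repr z).
by rewrite !bs_mul_class catA.
Qed.

Lemma bs_mul1 n : left_id (bs_one n) (@bs_mul n).
Proof. by move=> x; rewrite -(bs_class_repr x) bs_mul_class. Qed.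

Lemma bs_mulr1 n : right_id (bs_one n) (@bs_mul n).
Proof. by move=> x; rewrite -(bs_class_repr x) bs_mul_class cats0. Qed.

Lemma bs_mulV n : left_inverse (bs_one n) (@bs_inv n) (@bs_mul n).
Proof.
move=> x; rewrite -(bs_class_repr x) bs_inv_class bs_mul_class.
exact/bs_classP/bs_eq_mulVw.
Qed.

Lemma bs_mulrV n : right_inverse (bs_one n) (@bs_inv n) (@bs_mul n).
Proof.
move=> x; rewrite -(bs_class_repr x) bs_inv_class bs_mul_class.
exact/bs_classP/bs_eq_mulwV.
Qed.

HB.instance Definition _ n := isGroup.Build (BS n)
  (@bs_mulA n) (@bs_mul1 n) (@bs_mulr1 n) (@bs_mulV n) (@bs_mulrV n).

Local Open Scope group_scope.

Definition bs_a n : BS n := bs_class n [:: letter_a].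
Definition bs_t n : BS n := bs_class n [:: letter_t].

Lemma bs_classM n u v : bs_class n (u ++ v) = bs_class n u * bs_class n v.
Proof. by rewrite -bs_mul_class. Qed.

Lemma bs_classV n u : bs_class n (word_inv u) = (bs_class n u)^-1.
Proof. by rewrite -bs_inv_class. Qed.

Definition letter_val (G : groupType) (a t : G) (x : letter) : G :=
  let s := if x.1 then t else a in if x.2 then s^-1 else s.

Lemma bs_class_prod n u :
  bs_class n u = \prod_(x <- u) letter_val (bs_a n) (bs_t n) x.
Proof.
elim: u => [|x u IH]; first by rewrite big_nil.
rewrite big_cons -IH -cat1s bs_classM; congr (_ * _).
by case: x => [[] []]; rewrite /letter_val -?bs_classV.
Qed.

Lemma bs_relation n : bs_t n * bs_a n * (bs_t n)^-1 = bs_a n ^+ n.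
Proof.
have aX k : bs_class n (nseq k letter_a) = bs_a n ^+ k.
  by elim: k => [//|k IH]; rewrite expgS -IH -bs_classM.
by rewrite -aX -bs_classV -(bs_classM n [:: letter_t]) -bs_classM; apply/bs_classP; exact: (bs_eq_relator n).
Qed.

Lemma bs_universal n (G : groupType) (a t : G) : t * a * t^-1 = a ^+ n ->
  exists f : BS n -> G,
    [/\ forall g h, f (g * h) = f g * f h, f (bs_a n) = a & f (bs_t n) = t].
Proof.
move=> rel; pose F (u : word) := \prod_(x <- u) letter_val a t x.
have aX k : F (nseq k letter_a) = a ^+ k.
  elim: k => [|k IH]; first by rewrite /F big_nil.
  by rewrite expgS -IH /F big_cons.
have FE u v : bs_eq n u v -> F u = F v.
  elim=> {u v} [//|//|u v w _ -> _ -> //|u u' v v' _ + _|[x e]|].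
  - by rewrite /F !big_cat /= => -> ->.
  - rewrite /F !big_cons !big_nil mulg1 /letter_val /=.
    by case: e; rewrite /= ?mulVg ?mulgV.
  - by rewrite aX -rel /F !big_cons big_nil mulg1 /letter_val /= mulgA.
have FC u : F (repr (bs_class n u)) = F u by apply: FE; exact: bs_eq_repr.
exists (fun g => F (repr g)); split; rewrite ?FC /F ?big_seq1 // => g h.
rewrite -[in LHS](bs_class_repr g) -[in LHS](bs_class_repr h) -bs_classM.
by rewrite -!/(F _) FC /F big_cat.
Qed.

Lemma word_length_ex n (g : BS n) :
  exists k, `[< exists2 u : word, size u = k & bs_class n u = g >].
Proof.
by exists (size (repr g)); apply/asboolP; exists (repr g) => //; exact: reprK.
Qed.

Definition word_length n (g : BS n) : nat := ex_minn (word_length_ex g).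

Definition sphere n (r : nat) : set (BS n) := [set g | word_length g = r].

Arguments sphere : clear implicits.

Lemma finite_sphere n r : finite_set (sphere n r).
Proof.
apply: (@sub_finite_set _ _
    ((fun u : r.-tuple (bool * bool)%type => bs_class n u) @` setT)).
  move=> g; rewrite /sphere /= /word_length; case: ex_minnP => k /asboolP[u su <-].
  move=> _ kr; have sz : size u == r by rewrite su kr.
  by exists (Tuple sz).
exact/finite_image/finite_finset.
Qed.

Local Open Scope ring_scope.

(* fset_set turns a finite set of type set T into the {fset T} with the same
   elements; it is only applied to subsets of spheres, which are finite. *)

(* With division by 0 being 0, this is 0 when g = 1. *)
Definition kappa (R : realType) n (r : nat) (g : BS n) : R :=
  ((word_length g)%:R
    - #|` fset_set (sphere n r)|%:R^-1
      * \sum_(p <- fset_set (sphere n r)) (word_length (p^-1 * g * p)%g)%:R)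
  / (word_length g)%:R.

Definition positive_density (R : realType) n (A : set (BS n)) : Prop :=
  exists2 e : R, 0 < e & exists N0 : nat, forall N : nat, (N0 <= N)%N ->
    e < #|` fset_set (A `&` sphere n N)|%:R / #|` fset_set (sphere n N)|%:R
      < 1 - e.

(* Main.v *)
Require Import Defs.
From mathcomp Require Import all_boot all_order all_algebra.
From mathcomp Require Import finmap all_classical reals.
From mathcomp Require Import zify ring lra.

(** The group BS(1,n) is faithfully represented by pairs (x, k), x in Z[1/n] and
    k an integer, with (x, k)(y, l) = (x + n^k y, k + l), a = (1, 0) and
    t = (0, 1).  A word for (x, k) is a walk on the integers from 0 to k: the
    letters t and t^-1 are its steps, and a letter a or a^-1 met at position i
    adds n^i or -n^i to x.  Hence the length of (x, k) is the least value of
    sum |x_i| + 2 (m + M) - |k| over the expansions x = sum x_i n^i with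
    -m <= i <= M, where -m <= min(0, k) and max(0, k) <= M
    ([word_digits_raw], [word_length_digits]).

    Curvature.  Let H be n/2 rounded up.  A peak has digits 1, H, 0 at
    positions -1, 0, 1, then the digits of a cheapest expansion of an arbitrary
    integer u, then 1, 1 at positions k and k + 1, with k > 0.  A geodesic goes
    down to -1, up to k + 1 and back to k.  Conjugation by t or t^-1 shifts the
    digits by one place, and the range of the walk, which overshoots both 0 and
    k, only has to be shifted with them: the length does not grow.  Conjugation
    by a^-1 or a moves the digits at 0 and k by one unit in opposite directions.
    If the digit at 0 becomes H - 1, this pays for the digit 2 at k.  If it
    becomes H + 1, the carry H + 1 = n + (H + 1 - n) makes it cost at most H,
    while the digit at k disappears.  The four conjugates of a peak of length L
    thus have total length at most 4 L - 1 ([kappa_peak_gt0]).  That a peak is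
    not shorter than its digits suggest follows from [digit_split]: an expansion
    of y + n^(p+1) v, with |y| <= n^p, costs at least as much as separate
    expansions of y and v.

    Density.  With C = H + 23, the sphere of radius N injects into the set of
    peaks of length N + C: the data (x, k) of an element are written into the
    digits of u, separated by marks whose positions are recovered by
    divisibility by n ([sphere_le_peak]).  As the sphere of radius N + C has at
    most 4^C times as many elements as that of radius N, the proportion of peaks
    is at least 4^-C.  It is at most 1/2, because a peak has k > 0 and its
    inverse, which has the same length, does not. *)

Set Implicit Arguments.
Unset Strict Implicit.
Unset Printing Implicit Defensive.

Import Order.TTheory GRing.Theory Num.Theory.
Local Open Scope ring_scope.

(** * Signed base-n digits and their cost *)

Section Digits.
Context (n : nat) (hn : (3 <= n)%N).

Implicit Types (ds es : seq int) (d e y v : int) (p j : nat).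

Fixpoint digit_val ds : int :=
  if ds is d :: ds' then d + n%:Z * digit_val ds' else 0.

Fixpoint digit_cost ds : nat :=
  if ds is d :: ds' then (`|d| + digit_cost ds')%N else 0%N.

Lemma digit_val_cat ds es :
  digit_val (ds ++ es) = digit_val ds + n%:Z ^+ size ds * digit_val es.
Proof.
elim: ds => [|d ds IH] /=; first by rewrite expr0 mul1r add0r.
by rewrite IH exprS; ring.
Qed.

Lemma digit_cost_cat ds es :
  digit_cost (ds ++ es) = (digit_cost ds + digit_cost es)%N.
Proof. by elim: ds => [|d ds IH] //=; rewrite IH addnA. Qed.

Definition carry e ds : seq int :=
  if ds is d :: ds' then (e + d) :: ds' else [:: e].

Lemma carryP e ds :
  [/\ digit_val (carry e ds) = e + digit_val ds,
      (digit_cost (carry e ds) <= `|e| + digit_cost ds)%N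
    & size (carry e ds) = maxn 1 (size ds)].
Proof. by case: ds => [|d ds] /=; split; lia. Qed.

(** Division truncated towards 0, so that replacing a digit by its remainder
    saves n |e|, against a cost of at most |e| for the carry. *)
Lemma int_trunc_div d :
  exists d0 e, [/\ d = d0 + n%:Z * e, (`|d0| < n)%N
    & `|d|%N = (`|d0| + n * `|e|)%N].
Proof.
have n0 : (0 < n)%N by lia.
have E := divn_eq `|d| n; have L : (`|d| %% n < n)%N by rewrite ltn_mod.
case: (leP 0 d) => d0.
- exists (`|d| %% n)%N%:Z, (`|d| %/ n)%N%:Z; split; rewrite ?absz_nat //; lia.
- exists (- (`|d| %% n)%N%:Z), (- (`|d| %/ n)%N%:Z); split;
    rewrite ?abszN ?absz_nat //; lia.
Qed.

Lemma digit_min_ex y : exists s, `[< exists2 ds, digit_val ds = y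
   & digit_cost ds = s >].
Proof.
by exists `|y|%N; apply/asboolP; exists [:: y] => /=; [ring | rewrite addn0].
Qed.

(** The word norm on Z for the generators n^i.  The number of digits is free, so
    that this norm ignores the steps needed to reach them. *)
Definition digit_min y : nat := ex_minn (digit_min_ex y).

Lemma digit_min_le ds : (digit_min (digit_val ds) <= digit_cost ds)%N.
Proof.
by rewrite /digit_min; case: ex_minnP => s _; apply; apply/asboolP; exists ds.
Qed.

Lemma digit_minP y : exists2 ds, digit_val ds = y & digit_cost ds = digit_min y.
Proof. by rewrite /digit_min; case: ex_minnP => s /asboolP. Qed.

(** The lowest digit is y + n e, which for e <> 0 costs at least
    n |e| - 1 >= |e| + 1: it may be replaced by y, with e carried over. *)
Lemma digit_split_base ds y v j :
  digit_val ds = y + n%:Z * v -> (`|y| <= 1)%N -> (size ds <= j.+2)%N ->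
  exists es, [/\ digit_val es = v, (size es <= j.+1)%N
    & (`|y| + digit_cost es <= digit_cost ds)%N].
Proof.
case: ds => [|d ds] /= E y1 sz.
  have y0 : y = 0.
    apply/eqP; rewrite -absz_eq0; apply: contraT => yN0.
    have : (n %| `|y|)%N.
      have -> : y = - (n%:Z * v) by lia.
      by rewrite abszN abszM absz_nat dvdn_mulr.
    by move/dvdn_leq => /(_ _); lia.
  have v0 : v = 0.
    move: E; rewrite y0 add0r => /esym/eqP.
    by rewrite mulf_eq0 => /orP[|/eqP//]; lia.
  by exists [::]; rewrite v0 y0.
have E1 : d = y + n%:Z * (v - digit_val ds) by lia.
set e := v - _ in E1; have [V C S] := carryP e ds.
exists (carry e ds); split; rewrite ?V ?S; [lia | lia |].
have [e0|e0] := eqVneq e 0; first by move: C E1; rewrite e0; lia.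
have : (n * `|e| <= `|d| + `|y|)%N.
  by have := abszM n%:Z e; rewrite absz_nat; lia.
nia.
Qed.

(** The source of all lower bounds on length: when [y] is small against n^(p+1),
    no expansion of y + n^(p+1) v gains from carries between the two parts.  In
    the induction, the lowest digit is first reduced to |d0| < n; then
    |y| <= n^(p+1) and y = d0 + n y1 give |y1| <= n^p.  The sizes matter, because
    a walk that stops early can only use few digits. *)
Lemma digit_split p ds y v j :
  digit_val ds = y + n%:Z ^+ p.+1 * v -> (`|y| <= n ^ p)%N ->
  (size ds <= p.+1 + j.+1)%N ->
  exists ds1 ds2, [/\ digit_val ds1 = y, digit_val ds2 = v, (size ds1 <= p.+1)%N,
     (size ds2 <= j.+1)%N & (digit_cost ds1 + digit_cost ds2 <= digit_cost ds)%N].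
Proof.
elim: p ds y => [|p IH] ds y E yp sz.
  move: E; rewrite expr1 => E; have [es [V S C]] := digit_split_base E yp sz.
  by exists [:: y], es; rewrite /= mulr0 addr0 addn0.
wlog [d [ds' dsE]] : ds E sz / exists d ds', ds = d :: ds'.
  case: ds E sz => [|d ds] E sz W; last by apply: W => //; exists d, ds.
  by apply: (W [:: 0]); rewrite ?mulr0 //=; [rewrite -E mulr0 | exists 0, [::]].
move: E sz; rewrite {}dsE {ds} /=; move: ds' => ds E sz.
have [d0 [e [dE d0n dA]]] := int_trunc_div d.
have [V C S] := carryP e ds.
pose y1 := digit_val (carry e ds) - n%:Z ^+ p.+1 * v.
have yE : y = d0 + n%:Z * y1.
  by rewrite /y1 V; move: E; rewrite dE exprS; lia.
have y1p : (`|y1| <= n ^ p)%N.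
  have : (n * `|y1| <= `|y| + `|d0|)%N.
    by have := abszM n%:Z y1; rewrite absz_nat; lia.
  by move: yp; rewrite expnS; nia.
have Ey1 : digit_val (carry e ds) = y1 + n%:Z ^+ p.+1 * v by rewrite /y1; ring.
have sz1 : (size (carry e ds) <= p.+1 + j.+1)%N by rewrite S; lia.
have [ds1 [ds2 [V1 V2 S1 S2 C12]]] := IH _ _ Ey1 y1p sz1.
exists (d0 :: ds1), ds2; split => //=; first by rewrite V1 -yE.
by rewrite dA; nia.
Qed.

Lemma digit_min_short p y : (`|y| <= n ^ p)%N ->
  exists ds, [/\ digit_val ds = y, size ds = p.+1 & digit_cost ds = digit_min y].
Proof.
move=> yp; have [ds V C] := digit_minP y.
have E : digit_val ds = y + n%:Z ^+ p.+1 * 0 by rewrite mulr0 addr0.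
have sz : (size ds <= p.+1 + (size ds).+1)%N by lia.
have [ds1 [ds2 [V1 _ S1 _ C12]]] := digit_split E yp sz.
have V0 k : digit_val (nseq k 0) = 0 by elim: k => //= k ->; rewrite mulr0.
have C0 k : digit_cost (nseq k 0) = 0%N by elim: k.
exists (ds1 ++ nseq (p.+1 - size ds1) 0); split.
- by rewrite digit_val_cat V0 mulr0 addr0.
- by rewrite size_cat size_nseq; lia.
- rewrite digit_cost_cat C0; have := digit_min_le ds1; rewrite V1; lia.
Qed.

Lemma digit_min_split p y v : (`|y| <= n ^ p)%N ->
  digit_min (y + n%:Z ^+ p.+1 * v) = (digit_min y + digit_min v)%N.
Proof.
move=> yp; apply/eqP; rewrite eqn_leq; apply/andP; split.
  have [ds [V S <-]] := digit_min_short yp; have [es W <-] := digit_minP v.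
  by rewrite -digit_cost_cat -V -S -W -digit_val_cat; exact: digit_min_le.
have [ds V <-] := digit_minP (y + n%:Z ^+ p.+1 * v).
have sz : (size ds <= p.+1 + (size ds).+1)%N by lia.
have [ds1 [ds2 [V1 V2 _ _ C12]]] := digit_split V yp sz.
by have := digit_min_le ds1; have := digit_min_le ds2; rewrite V1 V2; lia.
Qed.

Lemma digit_min_gt0 y : y != 0 -> (0 < digit_min y)%N.
Proof.
have [ds <- <-] := digit_minP y; elim: ds => [|d ds IH] //=.
have [->|] := eqVneq d 0; last by lia.
by rewrite add0r mulf_eq0 negb_or => /andP[_ /IH]; lia.
Qed.

(** For e <> 0, writing y as (y - n e) + n e costs at least (n - |y|) + 1, which
    is no less than |y| exactly when 2 |y| <= n + 1. *)
Lemma digit_min_small y : (`|y| <= uphalf n)%N -> digit_min y = `|y|%N.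
Proof.
move=> yn; apply/eqP; rewrite eqn_leq; apply/andP; split.
  by have := digit_min_le [:: y]; rewrite /= mulr0 addr0 addn0.
have [[|d ds] /= V <-] := digit_minP y; first by lia.
have := digit_min_le ds; have := @digit_min_gt0 (digit_val ds).
have := abszM n%:Z (digit_val ds); rewrite absz_nat.
have : (uphalf n).*2 = (n + odd n)%N.
  by rewrite uphalf_half doubleD; have := odd_double_half n; case: odd; lia.
have [v0|v0] := eqVneq (digit_val ds) 0; first by rewrite v0 in V *; lia.
by move=> H E /(_ isT); nia.
Qed.

Lemma digit_strip i ds v j :
  digit_val ds = n%:Z ^+ i * v -> (size ds <= i + j.+1)%N ->
  exists es, [/\ digit_val es = v, (size es <= j.+1)%N
    & (digit_cost es <= digit_cost ds)%N].
Proof.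
case: i => [|i] E sz; first by exists ds; rewrite E expr0 mul1r.
rewrite -[_ * v]add0r in E.
have [//|zs [es [_ V _ S C]]] := digit_split E _ sz.
by exists es; split=> //; apply: leq_trans C; exact: leq_addl.
Qed.

(** Prolonging the range of the walk by one position costs two steps.  A carry e
    out of the top digit saves (n - 1) |e| >= 2, so it can afford this. *)
Lemma digit_normalize ds : (0 < size ds)%N ->
  exists es, [/\ digit_val es = digit_val ds, (size ds <= size es)%N,
    (`|digit_val es| < n ^ size es)%N
    & (digit_cost es + 2 * size es <= digit_cost ds + 2 * size ds)%N].
Proof.
have [k] := ubnP (size ds + digit_cost ds); elim: k ds => // k IH [//|d ds] lek _.
have [d0 [e [dE d0n dA]]] := int_trunc_div d.
have [V C S] := carryP e ds.
have [[ds0 e0]|nt] : (ds = [::] /\ e = 0) \/ (0 < size ds + `|e|)%N.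
- by case: (ds) => [|b ds']; [have [->|] := eqVneq e 0; [left | right; lia] | right].
- exists (d :: ds); rewrite ds0 /= expn1; split; lia.
have [||es [V' S' L' C']] := IH (carry e ds).
- by move: lek; rewrite /= dA S; nia.
- by rewrite S; lia.
have sz1 : (0 < size es)%N by lia.
exists (d0 :: es); rewrite /= V' V; split.
- by rewrite dE; ring.
- by lia.
- rewrite expnS -V -V'.
  by have := abszM n%:Z (digit_val es); rewrite absz_nat; nia.
- by rewrite dA; move: C' C; rewrite S; nia.
Qed.

End Digits.

(** * The affine representation, normal forms and word length *)

Section Affine.
Context (n : nat) (hn : (3 <= n)%N).

Definition aff_mul (g h : rat * int) : rat * int :=
  (g.1 + n%:R ^ g.2 * h.1, g.2 + h.2).

Definition aff_letter (x : letter) : rat * int :=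
  let s : int := if x.2 then -1 else 1 in if x.1 then (0, s) else (s%:~R, 0).

Definition aff_word (u : word) : rat * int :=
  foldr (fun x => aff_mul (aff_letter x)) (0, 0) u.

Lemma base_neq0 : n%:R != 0 :> rat.
Proof. by rewrite pnatr_eq0; lia. Qed.

Lemma aff_mulA : associative aff_mul.
Proof.
move=> [x k] [y l] [z m]; rewrite /aff_mul /=; congr (_, _); last by rewrite addrA.
by rewrite expfzDr ?base_neq0 //; ring.
Qed.

Lemma aff_mul0g g : aff_mul (0, 0) g = g.
Proof. by case: g => x k; rewrite /aff_mul /= expr0z mul1r !add0r. Qed.

Lemma aff_mulg0 g : aff_mul g (0, 0) = g.
Proof. by case: g => x k; rewrite /aff_mul /= mulr0 !addr0. Qed.

Lemma aff_word_cat u v : aff_word (u ++ v) = aff_mul (aff_word u) (aff_word v).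
Proof. by elim: u => [|x u IH] /=; rewrite ?aff_mul0g // IH aff_mulA. Qed.

Lemma aff_word_nseq_a e k :
  aff_word (nseq k (false, e)) = ((if e then - k%:R else k%:R), 0).
Proof.
elim: k => [|k IH] /=; first by rewrite oppr0; case: (e).
by rewrite IH /aff_mul /= expr0z mul1r addr0 -natr1; congr (_, _); case: (e) => /=; ring.
Qed.

Lemma aff_word_nseq_t e k :
  aff_word (nseq k (true, e)) = (0, (if e then - k%:Z else k%:Z)).
Proof.
elim: k => [|k IH] /=; first by case: (e).
by rewrite IH /aff_mul /= mulr0 addr0; congr (_, _); case: (e) => /=; lia.
Qed.

Lemma aff_word_eq u v : bs_eq n u v -> aff_word u = aff_word v.
Proof.
elim=> {u v} [//|//|u v w _ -> _ -> //|u u' v v' _ + _|[x e]|].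
- by rewrite !aff_word_cat => -> ->.
- rewrite /= /aff_mul /aff_letter /=; case: x; case: e => /=;
    by rewrite ?mulr0 ?expr0z ?addr0; congr (_, _); ring.
- rewrite aff_word_nseq_a /= /aff_mul /aff_letter /= expr1z.
  by congr (_, _); ring.
Qed.

Definition a_pow (y : int) : word := nseq `|y| (false, y < 0).

Lemma size_a_pow y : size (a_pow y) = `|y|%N.
Proof. by rewrite size_nseq. Qed.

Lemma aff_word_a_pow y : aff_word (a_pow y) = (y%:~R, 0).
Proof.
rewrite aff_word_nseq_a; congr (_, _); case: (ltP y 0) => y0.
  by rewrite -[y in RHS]opprK rmorphN /= -(ltz0_abs y0).
by rewrite -[y in RHS](gez0_abs y0).
Qed.

Section NormalForm.
Local Open Scope group_scope.
Local Notation a := (bs_a n).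
Local Notation t := (bs_t n).

(** Two natural exponents [p] and [q] stand for the integer exponent p - q. *)
Definition bs_nf (m p q j : nat) : BS n := t ^- m * (a ^+ p * a ^- q) * t ^+ j.

Lemma bs_taX p : t * a ^+ p = a ^+ (n * p) * t.
Proof.
elim: p => [|p IH]; first by rewrite muln0 mul1g mulg1.
have ta : t * a = a ^+ n * t by rewrite -bs_relation mulgVK.
by rewrite expgS mulgA ta mulnS expgnDr -!mulgA IH.
Qed.

Lemma bs_tXa j p : t ^+ j * a ^+ p = a ^+ (n ^ j * p) * t ^+ j.
Proof.
elim: j p => [|j IH] p; first by rewrite mul1n mul1g mulg1.
by rewrite expgSr -mulgA bs_taX mulgA IH -mulgA -expgSr expnSr mulnA.
Qed.

(** Brings two normal forms to the same power of t^-1, where they can be compared. *)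
Lemma bs_nf_raise i m p q j :
  bs_nf m p q j = bs_nf (m + i) (n ^ i * p) (n ^ i * q) (j + i).
Proof.
have E r : a ^+ (n ^ i * r) = t ^+ i * a ^+ r * t ^- i.
  by rewrite bs_tXa mulgK.
rewrite /bs_nf !E [(m + i)%N]addnC [(j + i)%N]addnC !expgnDr !invgM invgK.
by rewrite !mulgA !mulgVK.
Qed.

Lemma bs_nf_eq m p q p' q' j :
  (p + q' = p' + q)%N -> bs_nf m p q j = bs_nf m p' q' j.
Proof.
move=> E; rewrite /bs_nf; congr (_ * _ * _).
apply: (mulIg (a ^+ q)); rewrite mulgVK; apply: (mulIg (a ^+ q')).
rewrite -expgnDr E -!mulgA -(expgnDr a q q') [(q + q')%N]addnC.
by rewrite [in RHS]expgnDr mulKg expgnDr.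
Qed.

Lemma bs_nfP (g : BS n) : exists m p q j, g = bs_nf m p q j.
Proof.
rewrite -(bs_class_repr g); elim/last_ind: (repr g) => [|u x [m [p [q [j IH]]]]].
  by exists 0%N, 0%N, 0%N, 0%N; rewrite /bs_nf !expg0 invg1 !mulg1.
rewrite -cats1 bs_classM {}IH.
have -> : bs_class n [:: x] = letter_val a t x by rewrite bs_class_prod big_seq1.
case: x => [[] []] /=; rewrite /letter_val /=.
- rewrite (bs_nf_raise 1); exists (m + 1)%N, (n ^ 1 * p)%N, (n ^ 1 * q)%N, j.
  by rewrite /bs_nf [(j + 1)%N]addn1 [t ^+ j.+1]expgSr mulgA mulgK.
- by exists m, p, q, j.+1; rewrite /bs_nf expgSr !mulgA.
- exists m, p, (n ^ j + q)%N, j.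
  apply: (mulIg a); rewrite mulgVK /bs_nf -!mulgA; congr (_ * (_ * _)).
  rewrite -[X in _ * (_ * X)]expg1 bs_tXa muln1 expgnDr invgM -!mulgA.
  by rewrite [_^-1 * (a ^+ (n ^ j) * _)]mulKg.
- exists m, (p + n ^ j)%N, q, j.
  rewrite /bs_nf -!mulgA; congr (_ * _).
  rewrite -[X in _ * (_ * (_ * X)) = _]expg1 bs_tXa muln1 expgnDr -!mulgA; congr (_ * _).
  rewrite !mulgA; congr (_ * _); apply: (mulIg (a ^+ q)).
  by rewrite mulgVK -mulgA -expgnDr addnC expgnDr mulKg.
Qed.

End NormalForm.

Definition bs_aff (g : BS n) : rat * int := aff_word (repr g).

Lemma bs_aff_class u : bs_aff (bs_class n u) = aff_word u.
Proof. exact/aff_word_eq/bs_eq_repr. Qed.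

Lemma bs_affM g h : bs_aff (g * h)%g = aff_mul (bs_aff g) (bs_aff h).
Proof.
rewrite -(bs_class_repr g) -(bs_class_repr h) -bs_classM !bs_aff_class.
exact: aff_word_cat.
Qed.

Lemma bs_aff_a : bs_aff (bs_a n) = (1, 0).
Proof. by rewrite bs_aff_class /= aff_mulg0. Qed.

Lemma bs_aff_t : bs_aff (bs_t n) = (0, 1).
Proof. by rewrite bs_aff_class /= aff_mulg0. Qed.

Lemma bs_affV g :
  bs_aff g^-1%g = (- (n%:R ^ (- (bs_aff g).2) * (bs_aff g).1), - (bs_aff g).2).
Proof.
have : bs_aff (g^-1 * g)%g = (0, 0) by rewrite mulVg (bs_aff_class [::]).
rewrite bs_affM; case: (bs_aff g) => x k; case: (bs_aff _) => y l [E1 /= E2].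
have -> : - k = l by lia.
by congr (_, _); move: E1 => /=; lra.
Qed.

Lemma bs_aff_aX p : bs_aff (bs_a n ^+ p)%g = (p%:R, 0).
Proof.
elim: p => [|p IH]; first by rewrite expg0 (bs_aff_class [::]).
rewrite expgS bs_affM IH bs_aff_a /aff_mul /= expr0z mul1r -natr1.
by congr (_, _); ring.
Qed.

Lemma bs_aff_tX m : bs_aff (bs_t n ^+ m)%g = (0, m%:Z).
Proof.
elim: m => [|m IH]; first by rewrite expg0 (bs_aff_class [::]).
rewrite expgS bs_affM IH bs_aff_t /aff_mul /= mulr0.
by congr (_, _); lia.
Qed.

Lemma bs_aff_nf m p q j :
  bs_aff (bs_nf m p q j) = (n%:R ^- m * (p%:R - q%:R), j%:Z - m%:Z).
Proof.
rewrite /bs_nf !bs_affM !bs_affV !bs_aff_aX !bs_aff_tX /aff_mul /=.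
by rewrite !mulr0 oppr0 !expr0z -exprnN; congr (_, _); [ring | lia].
Qed.

(** Faithfulness: two normal forms with the same image agree once they are raised
    to a common level. *)
Lemma bs_aff_inj : injective bs_aff.
Proof.
move=> g h; have [m [p [q [j ->]]]] := bs_nfP g.
have [m' [p' [q' [j' ->]]]] := bs_nfP h.
rewrite !bs_aff_nf => -[E J]; rewrite (bs_nf_raise m') (bs_nf_raise m m').
have -> : (m' + m = m + m')%N by rewrite addnC.
have -> : (j' + m = j + m')%N by lia.
apply: bs_nf_eq; apply/eqP; rewrite -(eqr_nat rat) !natrD !natrM !natrX.
have Nm k : n%:R ^+ k != 0 :> rat by rewrite expf_neq0 ?base_neq0.
have E' : n%:R ^+ m' * (p%:R - q%:R) = n%:R ^+ m * (p'%:R - q'%:R) :> rat.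
  have -> : p%:R - q%:R = n%:R ^+ m * (n%:R ^- m * (p%:R - q%:R)) :> rat.
    by rewrite mulVKf.
  by rewrite E mulrCA mulVKf.
by apply/eqP; lra.
Qed.

Lemma word_length_le u : (word_length (bs_class n u) <= size u)%N.
Proof.
rewrite /word_length; case: ex_minnP => k _; apply.
by apply/asboolP; exists u.
Qed.

Lemma word_lengthP (g : BS n) :
  exists2 u, size u = word_length g & bs_class n u = g.
Proof. by rewrite /word_length; case: ex_minnP => k /asboolP. Qed.

Definition digit_word d (ds : seq int) : word :=
  a_pow d ++ flatten [seq letter_t :: a_pow e | e <- ds].

Lemma size_digit_word d ds :
  size (digit_word d ds) = (digit_cost (d :: ds) + size ds)%N.
Proof.
rewrite size_cat size_a_pow /= -addnA; congr addn.
by elim: ds => //= e ds IH; rewrite size_cat size_a_pow IH; lia.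
Qed.

Lemma aff_digit_word d ds :
  aff_word (digit_word d ds) = ((digit_val n (d :: ds))%:~R, (size ds)%:Z).
Proof.
rewrite aff_word_cat aff_word_a_pow /aff_mul /=.
have -> : aff_word (flatten [seq letter_t :: a_pow e | e <- ds])
    = ((n%:Z * digit_val n ds)%:~R, (size ds)%:Z).
  elim: ds => [|e ds IH] /=; first by rewrite mulr0.
  rewrite aff_word_cat IH aff_word_a_pow /aff_mul /= expr1z expr0z.
  by rewrite !rmorphM /= !rmorphD /= !rmorphM /=; congr (_, _); ring.
by rewrite /= expr0z mul1r rmorphD /= add0r.
Qed.

(** The word goes down to -m, then up through the digits, then [j] steps down. *)
Lemma word_length_digits (g : BS n) m j d ds :
  bs_aff g = (n%:R ^- m * (digit_val n (d :: ds))%:~R,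
              (size ds)%:Z - m%:Z - j%:Z) ->
  (word_length g <= m + digit_cost (d :: ds) + size ds + j)%N.
Proof.
move=> E.
have -> : g = bs_class n (nseq m letter_tV ++ digit_word d ds ++ nseq j letter_tV).
  apply: bs_aff_inj; rewrite E bs_aff_class 2!aff_word_cat aff_digit_word.
  rewrite !aff_word_nseq_t /aff_mul /= -exprnN.
  by congr (_, _); [ring | lia].
apply: leq_trans (word_length_le _) _.
by rewrite 2!size_cat !size_nseq size_digit_word; lia.
Qed.

Fixpoint add_digit i e (ds : seq int) : seq int :=
  match i, ds with
  | _, [::] => [::]
  | 0, d :: ds' => (e + d) :: ds'
  | i'.+1, d :: ds' => d :: add_digit i' e ds'
  end.

Lemma size_add_digit i e ds : size (add_digit i e ds) = size ds.
Proof. by elim: ds i => [|d ds IH] [|i] //=; rewrite IH. Qed.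

Lemma cost_add_digit i e ds :
  (digit_cost (add_digit i e ds) <= `|e| + digit_cost ds)%N.
Proof. by elim: ds i => [|d ds IH] [|i] //=; [lia | have := IH i; lia]. Qed.

Lemma val_add_digit i e ds : (i < size ds)%N ->
  digit_val n (add_digit i e ds) = digit_val n ds + n%:Z ^+ i * e.
Proof.
elim: ds i => [|d ds IH] [|i] //= lti; first by rewrite expr0; ring.
by rewrite IH // exprS; ring.
Qed.

(** Follow the walk letter by letter: a or a^-1 changes the digit at the current
    position, and a step of the walk leaves the digits alone except that it
    opens a new position, at the price 2 - 1, when it leaves the range. *)
Lemma word_digits_raw u : let: (x, k) := aff_word u in
  exists m M ds,
  [/\ size ds = (m + M).+1, - m%:Z <= k <= M%:Z,
      n%:R ^+ m * x = (digit_val n ds)%:~R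
    & (digit_cost ds + 2 * (m + M) <= size u + `|k|)%N].
Proof.
elim/last_ind: u => [|u l] /=.
  by exists 0%N, 0%N, [:: 0]; split=> //=; rewrite !mulr0.
have El : aff_word [:: l] = aff_letter l by rewrite /= aff_mulg0.
rewrite -cats1 aff_word_cat size_cat addn1 El.
case: (aff_word u) => x k [m [M [ds [S /andP[mk kM] V C]]]].
case: l El => [[] e] _; rewrite /aff_mul /aff_letter /=; last first.
  set s : int := if e then -1 else 1.
  have s1 : `|s|%N = 1%N by rewrite /s; case: (e).
  pose i := absz (m%:Z + k).
  have Ei : i%:Z = m%:Z + k by lia.
  exists m, M, (add_digit i s ds); rewrite addr0 size_add_digit.
  split=> //; first by rewrite mk.
    rewrite val_add_digit ?S; last by lia.
    rewrite mulrDr V rmorphD rmorphM rmorphXn /=; congr (_ + _).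
    by rewrite mulrA (exprnP _ m) -expfzDr ?base_neq0 // -Ei.
  by have := cost_add_digit i s ds; lia.
rewrite mulr0 addr0; case: e.
  have [lt|ge] := ltP (- m%:Z) k.
    by exists m, M, ds; split=> //; lia.
  exists m.+1, M, (0 :: ds); split=> /=; [lia | lia | | lia].
  by rewrite add0r exprS -mulrA V rmorphM.
have [lt|ge] := ltP k M%:Z.
  by exists m, M, ds; split=> //; lia.
exists m, M.+1, (ds ++ [:: 0]); rewrite size_cat digit_cost_cat digit_val_cat /=.
by split; [lia | lia | rewrite V !mulr0 !addr0 | lia].
Qed.

(** The bound on the value confines [digit_val n ds] to the range of the walk; it
    is what allows the expansion to be written between other digits. *)
Lemma word_digits u : let: (x, k) := aff_word u in
  exists m M ds,
  [/\ size ds = (m + M).+1, - m%:Z <= k <= M%:Z,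
      n%:R ^+ m * x = (digit_val n ds)%:~R,
      (digit_cost ds + 2 * (m + M) <= size u + `|k|)%N
    & (`|digit_val n ds| < n ^ (m + M).+1)%N].
Proof.
have := word_digits_raw u; case: (aff_word u) => x k [m [M [ds [S kB V C]]]].
have [|es [V' S' L' C']] := digit_normalize hn (ds := ds); first by rewrite S.
exists m, (M + (size es - size ds))%N, es.
have Ees : size es = (m + (M + (size es - size ds))).+1 by lia.
by split; rewrite -?Ees ?V' //; lia.
Qed.

End Affine.

(** * Peaks: elements of positive curvature *)

Section Family.
Context (n : nat) (hn : (3 <= n)%N).

Lemma uphalf_bounds : (n <= 2 * uphalf n <= n.+1)%N.
Proof.
rewrite uphalf_half; have := odd_double_half n; rewrite -muln2.
by case: odd => /=; lia.
Qed.

(** [digit_split] in the form used to remove known low digits one block at a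
    time while recording their cost. *)
Lemma digit_chop p ds y v j :
  digit_val n ds = y + n%:Z ^+ p.+1 * v -> (`|y| <= n ^ p)%N ->
  (size ds <= p.+1 + j.+1)%N ->
  exists es, [/\ digit_val n es = v, (size es <= j.+1)%N
     & (digit_min n y + digit_cost es <= digit_cost ds)%N].
Proof.
move=> E yp sz; have [ds1 [es [V1 V2 _ S2 C]]] := digit_split hn E yp sz.
by exists es; split=> //; have := digit_min_le n ds1; rewrite V1; lia.
Qed.

(** n x for a peak (x, p + 3): the factor n makes room for the digit at -1, and
    the two top digits lie at the positions k = p + 3 and k + 1. *)
Definition peak_num p (u : int) : int :=
  1 + n%:Z * ((uphalf n)%:Z + n%:Z ^+ 2 * (u + n%:Z ^+ p.+1 * (1 + n%:Z))).

Definition bs_peak p u (g : BS n) : Prop :=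
  (`|u| <= n ^ p)%N /\ bs_aff g = (n%:R^-1 * (peak_num p u)%:~R, p.+3%:Z).

(** The digits cost 1 + H + digit_min u + 2 and the walk takes
    2 (1 + (k + 1)) - k = k + 4 = p + 7 steps. *)
Definition peak_length p u : nat := (uphalf n + digit_min n u + p + 10)%N.

(** One bound for a peak and its four conjugates.  The lowest digit sits at -m
    and the highest at k + j, so that m + j = 2 is the overshoot of the walk:
    m = 1 for the peak itself and its conjugates by a and a^-1, m = 0 or 2 after
    a shift.  The digit at k, and those at 0 and 1, are left variable. *)
Lemma word_length_peak_digits (g : BS n) p (u : int) m j (c h0 h1 k0 : int) :
  (`|u| <= n ^ p)%N -> (m + j = 2)%N ->
  bs_aff g = (n%:R ^- m * (c + n%:Z * (h0 + n%:Z * (h1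
     + n%:Z * (u + n%:Z ^+ p.+1 * (k0 + n%:Z))))%R)%:~R, p.+3%:Z) ->
  (word_length g <= `|c| + `|h0| + `|h1| + digit_min n u + `|k0| + p + 8)%N.
Proof.
move=> up mj E; have [U [V S C]] := digit_min_short hn up.
have := @word_length_digits n hn g m j c (h0 :: h1 :: U ++ [:: k0; 1]).
rewrite E /= digit_val_cat digit_cost_cat size_cat S V C /= => H.
apply: leq_trans (H _) _; last by lia.
congr (_ * _%:~R, _); first by ring.
by lia.
Qed.

(** The digit 1 at position -1 makes x a non-integer, so the walk must visit -1.
    After the low digits are chopped off, 1 + n remains at position k.  A walk
    that goes to k + 1 pays two digits and two more steps; one that does not
    pays n + 1 >= 4 units at k. *)
Lemma word_length_peak_ge g p u :
  bs_peak p u g -> (peak_length p u <= word_length g)%N.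
Proof.
move=> [up E]; have [w <- wg] := word_lengthP g; rewrite -wg (bs_aff_class hn) in E.
have := word_digits_raw hn w; rewrite E => -[m [M [ds [S kB V C]]]].
have n0 := base_neq0 hn.
have [i mE] : exists i, m = i.+1.
  case: m {S kB C} V => [|i _]; last by exists i.
  rewrite expr0 mul1r => V.
  have : peak_num p u = n%:Z * digit_val n ds.
    by apply/eqP; rewrite -(eqr_int rat) rmorphM /= -V mulVKf.
  rewrite /peak_num => E1; suff : n = 1%N by lia.
  set z := (X in 1 + n%:Z * X = _) in E1.
  have : (n%:Z %| 1)%Z by apply/dvdzP; exists (digit_val n ds - z); lia.
  by rewrite dvdzE absz_nat dvdn1 => /eqP.
rewrite {}mE in S kB V C.
have V0 : digit_val n ds = n%:Z ^+ i * peak_num p u.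
  apply/eqP; rewrite -(eqr_int rat) -V exprSr -mulrA mulVKf //.
  by rewrite rmorphM rmorphXn.
have [|es [V1 S1 C1]] := digit_strip hn (j := M.+1) V0; first by lia.
have up0 : (uphalf n <= n)%N by have := uphalf_bounds; lia.
rewrite /peak_num -{1}[n%:Z]expr1 in V1.
have [||es1 [V2 S2 C2]] := digit_chop V1 (j := M); rewrite ?expn0 //.
have [||es2 [V3 S3 C3]] := digit_chop V2 (j := (M - 2)%N).
- by rewrite expn1 absz_nat.
- by lia.
have [||es3 [V4 S4 C4]] := digit_chop V3 (j := (M - p.+3)%N) => //.
  by lia.
rewrite (digit_min_small hn) // absz1 in C2; last by have := uphalf_bounds; lia.
rewrite (digit_min_small hn) // absz_nat in C3.
(* The walk reaches k + 1 in the first case, and stops at k in the second. *)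
have [lt|ge] := ltnP p.+3 M.
  have : digit_min n (1 + n%:Z ^+ 1 * 1) = 2%N.
    rewrite (digit_min_split hn) ?expn0 // (digit_min_small hn) //.
    by have := uphalf_bounds; lia.
  have := digit_min_le n es3; rewrite V4 expr1 mulr1 /peak_length; lia.
have : (n.+1 <= digit_cost es3)%N.
  have sz1 : (size es3 <= 1)%N by lia.
  by clear - hn V4 sz1; case: es3 V4 sz1 => [|d [|? ?]] //= V4 _; lia.
by rewrite /peak_length; lia.
Qed.

Lemma word_length_peak g p u :
  bs_peak p u g -> word_length g = peak_length p u.
Proof.
move=> gc; apply/eqP; rewrite eqn_leq word_length_peak_ge // andbT.
case: gc => up E.
have := @word_length_peak_digits g p u 1 1 1 (uphalf n) 0 1 up erefl.
rewrite E expr1 /peak_length => H; apply: leq_trans (H _) _; last by lia.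
by rewrite /peak_num; congr (_ * _%:~R, _); ring.
Qed.

Lemma bs_aff_conj (g h : BS n) : bs_aff (h^-1 * g * h)%g =
  (n%:R ^ (- (bs_aff h).2) * ((bs_aff g).1 - (bs_aff h).1
     + n%:R ^ (bs_aff g).2 * (bs_aff h).1), (bs_aff g).2).
Proof.
have n0 := base_neq0 hn.
rewrite !bs_affM // bs_affV // /aff_mul /= expfzDr //; congr (_, _); last by lia.
by rewrite mulrDr mulrBr mulrA [X in _ = X + _]addrC.
Qed.

(** The digits of x / n are those of x, one place lower. *)
Lemma word_length_conj_peak_t g p u : bs_peak p u g ->
  (word_length ((bs_t n)^-1 * g * bs_t n)%g <= peak_length p u)%N.
Proof.
move=> [up E].
have := @word_length_peak_digits ((bs_t n)^-1 * g * bs_t n)%g p u 2 0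
  1 (uphalf n) 0 1 up erefl.
rewrite /peak_length => H; apply: leq_trans (H _) _; last by lia.
rewrite bs_aff_conj bs_aff_t // E /=; congr (_, _).
rewrite /peak_num expr2 invfM mulr0 subr0 addr0 mulrA.
by congr (_ * _%:~R); ring.
Qed.

Lemma word_length_conj_peak_tV g p u : bs_peak p u g ->
  (word_length ((bs_t n)^-1^-1 * g * (bs_t n)^-1)%g <= peak_length p u)%N.
Proof.
move=> [up E]; have n0 := base_neq0 hn.
have := @word_length_peak_digits ((bs_t n)^-1^-1 * g * (bs_t n)^-1)%g p u 0 2
  1 (uphalf n) 0 1 up erefl.
rewrite /peak_length => H; apply: leq_trans (H _) _; last by lia.
rewrite bs_aff_conj bs_affV // bs_aff_t // E /= opprK expr1z; congr (_, _).
rewrite !(mulr0, oppr0, addr0) (mulVKf n0) expr0 invr1 mul1r /peak_num.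
by congr (_%:~R); ring.
Qed.

Lemma peak_shift (z s : int) p :
  n%:R^-1 * z%:~R + s%:~R * (n%:R ^ p.+3%:Z - 1)
    = n%:R^-1 * (z + s * (n%:Z ^+ p.+4 - n%:Z))%:~R :> rat.
Proof.
have n0 := base_neq0 hn; apply: (mulfI n0).
rewrite mulVKf // mulrDr mulVKf // rmorphD rmorphM rmorphB rmorphXn /=.
by congr (_ + _); rewrite -exprnP mulrCA exprS; congr (_ * _); rewrite mulrBr mulr1.
Qed.

(** n^k - 1 is added to x: the digit at 0 drops to H - 1 and the one at k rises
    to 2. *)
Lemma word_length_conj_peak_a g p u : bs_peak p u g ->
  (word_length ((bs_a n)^-1 * g * bs_a n)%g <= peak_length p u)%N.
Proof.
move=> [up E]; have hb := uphalf_bounds.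
have := @word_length_peak_digits ((bs_a n)^-1 * g * bs_a n)%g p u 1 1
  1 ((uphalf n)%:Z - 1) 0 2 up erefl.
rewrite /peak_length => H; apply: leq_trans (H _) _; last by lia.
rewrite bs_aff_conj bs_aff_a // E /= oppr0 expr0z mul1r mulr1; congr (_, _).
rewrite -addrA [- 1 + _]addrC -[X in _ + X]mul1r (peak_shift _ 1) expr1.
by congr (_ * _%:~R); rewrite /peak_num !exprS; ring.
Qed.

(** n^k - 1 is subtracted from x: the digit at k vanishes, and the digit H + 1 at
    0 is replaced by H + 1 - n with a carry, at the cost n - H <= H in all. *)
Lemma word_length_conj_peak_aV g p u : bs_peak p u g ->
  (word_length ((bs_a n)^-1^-1 * g * (bs_a n)^-1)%g < peak_length p u)%N.
Proof.
move=> [up E]; have hb := uphalf_bounds.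
have := @word_length_peak_digits ((bs_a n)^-1^-1 * g * (bs_a n)^-1)%g p u 1 1
  1 ((uphalf n)%:Z + 1 - n%:Z) 1 0 up erefl.
rewrite /peak_length => H; apply: leq_ltn_trans (H _) _; last by lia.
rewrite bs_aff_conj bs_affV // bs_aff_a // E /= oppr0 expr0z !mul1r.
rewrite mulrN1 opprK; congr (_, _).
rewrite -addrA -opprB -[X in _ + X]mulN1r (peak_shift _ (-1)) expr1.
by congr (_ * _%:~R); rewrite /peak_num !exprS; ring.
Qed.

Lemma sphere1_perm : perm_eq (fset_set (sphere n 1))
  [:: bs_a n; (bs_a n)^-1; bs_t n; (bs_t n)^-1]%g.
Proof.
have aVE : bs_aff (bs_a n)^-1%g = (-1, 0).
  by rewrite bs_affV // bs_aff_a //= oppr0 expr0z mul1r.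
have tVE : bs_aff (bs_t n)^-1%g = (0, -1).
  by rewrite bs_affV // bs_aff_t //= mulr0 oppr0.
apply: uniq_perm; first exact: fset_uniq.
  by apply: (@map_uniq _ _ (@bs_aff n)); rewrite /= aVE tVE bs_aff_a // bs_aff_t.
move=> g; rewrite in_fset_set; last exact: finite_sphere.
apply/idP/idP => [|gl].
  rewrite inE => g1; have [u su <-] := word_lengthP g.
  rewrite g1 in su; case: u su => [//|x [|//]] _.
  rewrite bs_class_prod big_seq1 !inE /letter_val.
  by case: x => [[] []] /=; rewrite eqxx ?orbT.
have [x gE] : exists x, g = bs_class n [:: x].
  move: gl; rewrite !inE => /or4P[]/eqP->.
  - by exists letter_a.
  - by exists letter_aV; rewrite -bs_classV.
  - by exists letter_t.
  - by exists letter_tV; rewrite -bs_classV.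
have g1 : g != 1%g.
  apply: contraTneq gl => g1; apply/negP.
  move/(map_f (@bs_aff n)); rewrite g1 (bs_aff_class hn [::]) /=.
  by rewrite aVE tVE bs_aff_a // bs_aff_t.
rewrite inE /sphere /=; apply/eqP; rewrite eqn_leq {1}gE word_length_le /=.
rewrite lt0n; apply: contra g1 => /eqP g0; have [u su <-] := word_lengthP g.
by move: su; rewrite g0 => /size0nil ->.
Qed.

Lemma kappa_peak_gt0 (R : realType) g p u : bs_peak p u g -> 0 < kappa R 1 g.
Proof.
move=> gc; have L := word_length_peak gc; rewrite /kappa.
have L0 : (0 : R) < (word_length g)%:R by rewrite ltr0n L /peak_length; lia.
rewrite divr_gt0 // subr_gt0 (perm_size sphere1_perm) (perm_big _ sphere1_perm) /=.
rewrite !big_cons big_nil addr0 ltr_pdivrMl ?ltr0n // -!natrD -natrM ltr_nat.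
have := word_length_conj_peak_a gc; have := word_length_conj_peak_aV gc.
by have := word_length_conj_peak_t gc; have := word_length_conj_peak_tV gc; lia.
Qed.

End Family.

(** * The density of peaks *)

Section Density.
Local Open Scope classical_set_scope.
Context (n : nat) (hn : (3 <= n)%N).

Lemma card_fset_set_inj (T : choiceType) (A B : set T) (f : T -> T) :
  finite_set A -> finite_set B -> (forall x, A x -> B (f x)) ->
  (forall x y, A x -> A y -> f x = f y -> x = y) ->
  (#|` fset_set A| <= #|` fset_set B|)%N.
Proof.
move=> fA fB AB fI.
have <- : #|` [fset f x | x in fset_set A]%fset| = #|` fset_set A|.
  apply: card_in_imfset => x y; rewrite !in_fset_set // !inE; exact: fI.
apply/fsubset_leq_card/fsubsetP => _ /imfsetP[x /= + ->].
by rewrite !in_fset_set // !inE; exact: AB.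
Qed.

(** A digit e = 1 or -1, then q zeros, then the digits of [w]. *)
Definition mark q (w e : int) : int := e + n%:Z ^+ q.+1 * w.

Lemma mark_min q w e : `|e|%N = 1%N -> digit_min n (mark q w e) = (digit_min n w).+1.
Proof.
move=> e1; rewrite (digit_min_split hn) ?e1 ?expn_gt0; last by lia.
by rewrite (digit_min_small hn) e1 ?add1n //; have := uphalf_bounds hn; lia.
Qed.

Lemma mark_bound q w e b : `|e|%N = 1%N -> (`|w| <= n ^ b)%N ->
  (`|mark q w e| <= n ^ (q + b + 2))%N.
Proof.
move=> e1 wb; rewrite /mark.
have -> : (n ^ (q + b + 2) = n * (n ^ q.+1 * n ^ b))%N.
  by rewrite -expnD -expnS; congr expn; lia.
have H : (`|(n%:Z ^+ q.+1 * w)%R| <= n ^ q.+1 * n ^ b)%N.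
  by rewrite abszM abszX absz_nat leq_mul.
have : (0 < n ^ q.+1 * n ^ b)%N by rewrite muln_gt0 !expn_gt0; lia.
by move: (n ^ q.+1 * n ^ b)%N H => X H X0; nia.
Qed.

Lemma mark_ndvd q w e : `|e|%N = 1%N -> ~~ (n%:Z %| mark q w e)%Z.
Proof.
move=> e1; rewrite /mark exprS -mulrA rpredDr ?dvdz_mulr //.
by rewrite dvdzE e1 absz_nat dvdn1; lia.
Qed.

(** Modulo n the mark gives e, since 1 and -1 are distinct for n >= 3; then q is
    the number of times n divides what is left. *)
Lemma mark_inj q q' w w' e e' : `|e|%N = 1%N -> `|e'|%N = 1%N ->
  ~~ (n%:Z %| w)%Z -> ~~ (n%:Z %| w')%Z -> mark q w e = mark q' w' e' ->
  [/\ e = e', q = q' & w = w'].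
Proof.
move=> e1 e1' nw nw' E.
have N0 k : n%:Z ^+ k != 0 by rewrite expf_neq0 //; lia.
have ee : e = e'.
  have : (n%:Z %| e - e')%Z.
    have -> : e - e' = n%:Z * (n%:Z ^+ q' * w' - n%:Z ^+ q * w).
      by move: E; rewrite /mark !exprS; lia.
    exact: dvdz_mulr.
  move/dvdzP => [c cE]; have [c0|c0] := eqVneq c 0; first by rewrite c0 in cE; lia.
  have := abszM c n%:Z; rewrite -cE absz_nat; nia.
have {}E : n%:Z ^+ q * w = n%:Z ^+ q' * w'.
  apply: (mulfI (N0 1%N)); move: E; rewrite /mark ee => /addrI.
  by rewrite !exprS expr0 !mulr1 !mulrA.
suff qq : q = q' by split=> //; move: E; rewrite qq => /(mulfI (N0 q')).
wlog lt : q q' w w' nw nw' {e e' e1 e1' ee} E / (q < q')%N.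
  by move=> W; have [lt|lt|//] := ltngtP q q'; [exact: (W q q' w w')|];
    by apply/esym; exact: (W q' q w' w).
move: nw; rewrite -(subnKC lt) addSnnS exprD -mulrA in E.
by rewrite (mulfI (N0 q) E) exprS -mulrA dvdz_mulr.
Qed.

Definition sign_int (b : bool) : int := if b then -1 else 1.

(** The integer u of the peak that stands for an element (n^-m y, k), whose walk
    has range [-m, M].  Here al = M - max(k, 0) and be = m - max(-k, 0) are the
    overshoots at both ends and [b] tells whether k < 0.  The number [s] is the
    amount by which the radius exceeds the cost found from [digit_min]; walking
    through [s] zeros makes the length of the peak come out right.  The last
    mark, with no zeros, ends the run of [s] zeros whatever [y] is. *)
Definition peak_code (al be s : nat) (b : bool) (y : int) : int :=
  mark al (mark be (mark s (mark 0 y 1) 1) 1) (sign_int b).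

(** An exponent of n that bounds [peak_code].  With ka = |k| the range of the walk
    has al + be + ka + 1 positions, and each of the four marks adds 2
    ([mark_bound]).  As the size of the peak is part of its data, it
    also carries the value of [ka]. *)
Definition peak_code_size (al be s ka : nat) : nat :=
  (al + be + s + (al + be + ka) + 9)%N.

(** The middle equation says that the length of [g], computed with the norm
    [digit_min] and increased by the slack [s], is the radius [N]. *)
Definition encodes (N : nat) (g h : BS n) : Prop :=
  exists (al be s ka : nat) (b : bool) (y : int),
  [/\ bs_aff g = (n%:R ^- (be + b * ka) * y%:~R, sign_int b * ka%:Z),
      (digit_min n y + 2 * (al + be) + ka + s = N)%N &
      bs_peak (peak_code_size al be s ka) (peak_code al be s b y) h].

Lemma peak_exists p u : (`|u| <= n ^ p)%N -> exists h : BS n, bs_peak p u h.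
Proof.
move=> up; have [x [z xz]] : exists x z : nat, peak_num n p u = x%:Z - z%:Z.
  by case: (peak_num n p u) => k; [exists k, 0%N | exists 0%N, k.+1]; lia.
exists (bs_nf n 1 x z p.+4); split=> //.
rewrite (bs_aff_nf hn) xz rmorphB expr1; congr (_, _); lia.
Qed.

Lemma peak_inj p p' u u' (h : BS n) :
  bs_peak p u h -> bs_peak p' u' h -> p = p' /\ u = u'.
Proof.
have n0 := base_neq0 hn; have N0 : n%:Z != 0 by lia.
move=> [_ hE] [_]; rewrite hE => -[E pE]; have {}pE : p = p' by lia.
split=> //; move: E; rewrite -pE => /(mulfI (invr_neq0 n0)) /eqP.
rewrite eqr_int => /eqP /addrI /(mulfI N0) /addrI /(mulfI (expf_neq0 2 N0)).
exact: addIr.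
Qed.

(** Take a shortest word for g and its normalized digits.  They need not have the
    cost [digit_min y], as the walk may be too short for an optimal expansion:
    the difference goes into [s]. *)
Lemma encodes_exists N (g : BS n) : sphere n N g -> exists h, encodes N g h.
Proof.
move=> gN; have [w wN wg] := word_lengthP g; rewrite gN in wN.
have := word_digits hn w; rewrite -(bs_aff_class hn) wg; case E : (bs_aff g) => [x k].
move=> [m [M [ds [S kB V C B]]]].
pose y := digit_val n ds; pose b := k < 0; pose ka := `|k|%N.
pose be := (m - b * ka)%N; pose al := (M - ~~ b * ka)%N.
have mE : m = (be + b * ka)%N by rewrite /be /b /ka; case: ltP => ? /=; lia.
have ME : M = (al + ~~ b * ka)%N by rewrite /al /b /ka; case: ltP => ? /=; lia.
have kE : k = sign_int b * ka%:Z by rewrite /b /ka /sign_int; case: ltP => ?; lia.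
have K : (m + M = al + be + ka)%N by rewrite mE ME; case: (b) => /=; lia.
have C1 := digit_min_le n ds.
pose s := (N - (digit_min n y + 2 * (al + be) + ka))%N.
have yB : (`|y| <= n ^ (al + be + ka).+1)%N by rewrite -K ltnW.
have [|h hc] := @peak_exists (peak_code_size al be s ka) (peak_code al be s b y).
  have s1 : `|sign_int b|%N = 1%N by case: (b).
  have u1 : `|1 : int|%N = 1%N by [].
  have := mark_bound al s1 (mark_bound be u1 (mark_bound s u1 (mark_bound 0 u1 yB))).
  by congr (_ <= n ^ _)%N; rewrite /peak_code_size; lia.
exists h, al, be, s, ka, b, y; split=> //.
- rewrite -mE -kE E; congr (_, _); rewrite /y -V mulKf //.
  by rewrite expf_neq0 // base_neq0.
- by rewrite /s; move: C C1; rewrite -/y -/ka K wN; lia.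
Qed.

(** The constant is 4 for the digits of the marks, 9 from [peak_code_size] and
    H + 10 from [peak_length]. *)
Lemma encodes_length N (g h : BS n) :
  encodes N g h -> word_length h = (N + (uphalf n + 23))%N.
Proof.
move=> [al [be [s [ka [b [y [_ NE /(word_length_peak hn) ->]]]]]]].
have s1 : `|sign_int b|%N = 1%N by case: (b).
by rewrite /peak_length /peak_code !mark_min // /peak_code_size; lia.
Qed.

(** The marks give b, al, be, s and y from the lowest digit upwards; then ka is
    read off from the size of the peak. *)
Lemma encodes_inj N (g g' h : BS n) : encodes N g h -> encodes N g' h -> g = g'.
Proof.
move=> [al [be [s [ka [b [y [gE _ c]]]]]]] [al' [be' [s' [ka' [b' [y' [gE' _ c']]]]]]].
have [pE uE] := peak_inj c c'.
have s1 c0 : `|sign_int c0|%N = 1%N by case: c0.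
have [| | | |bE alE] := mark_inj _ _ _ _ uE; rewrite ?s1 ?mark_ndvd //.
move=> /mark_inj[]; rewrite ?mark_ndvd // => _ beE.
move=> /mark_inj[]; rewrite ?mark_ndvd // => _ sE /addrI.
have N0 : n%:Z ^+ 1 != 0 by rewrite expr1; lia.
move=> /(mulfI N0) yE.
have bb : b = b' by move: bE; case: (b); case: (b').
have kaE : ka = ka' by move: pE; rewrite /peak_code_size; lia.
by apply: (bs_aff_inj hn); rewrite gE gE' bb kaE beE yE.
Qed.

Definition peak_set : set (BS n) := [set g | exists p u, bs_peak p u g].

Lemma finite_peak_sphere N : finite_set (peak_set `&` sphere n N).
Proof. by apply: finite_setIr; exact: finite_sphere. Qed.

Lemma sphere_le_peak N :
  (#|` fset_set (sphere n N)|
    <= #|` fset_set (peak_set `&` sphere n (N + (uphalf n + 23)))|)%N.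
Proof.
have /choice[f fP] (g : BS n) : exists h, sphere n N g -> encodes N g h.
  have [/encodes_exists[h gh]|gN] := pselect (sphere n N g); first by exists h.
  by exists g.
apply: (@card_fset_set_inj _ _ _ f).
- exact: finite_sphere.
- exact: finite_peak_sphere.
- move=> g /fP gf; split; last exact: encodes_length gf.
  by case: gf => [al [be [s [ka [b [y [_ _ c]]]]]]]; eexists; eexists; exact: c.
- move=> g g' /fP gf /fP gf' E; apply: encodes_inj gf _; by rewrite E.
Qed.

Lemma sphere_succ N :
  (#|` fset_set (sphere n N.+1)| <= 4 * #|` fset_set (sphere n N)|)%N.
Proof.
pose F (x : letter) := [fset g * bs_class n [:: x] | g in fset_set (sphere n N)]%fset%g.
have cF x : (#|` F x| <= #|` fset_set (sphere n N)|)%N by exact: leq_imfset_card.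
have cU (X Y : {fset BS n}) : (#|` (X `|` Y)%fset| <= #|` X| + #|` Y|)%N.
  by rewrite -cardfsUI leq_addr.
have sub : (fset_set (sphere n N.+1) `<=`
    (F letter_a `|` F letter_aV) `|` (F letter_t `|` F letter_tV))%fset.
  apply/fsubsetP => g; rewrite in_fset_set ?inE; last exact: finite_sphere.
  move=> gN; have [w wN wg] := word_lengthP g; rewrite gN in wN.
  case/lastP: w wN wg => [//|w x]; rewrite size_rcons => -[wN] wg.
  have gF : g \in F x.
    apply/imfsetP; exists (bs_class n w) => /=; last by rewrite -wg -cats1 bs_classM.
    rewrite in_fset_set ?inE; last exact: finite_sphere.
    apply/eqP; rewrite eqn_leq -{1}wN word_length_le /=.
    have [v vN vw] := word_lengthP (bs_class n w).
    have := word_length_le n (rcons v x).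
    rewrite -cats1 bs_classM vw -bs_classM cats1 wg gN size_cat addn1 vN.
    by rewrite ltnS.
  by case: x wg gF => [[] []] _ -> ; rewrite ?orbT.
apply: leq_trans (fsubset_leq_card sub) _; apply: leq_trans (cU _ _) _.
by rewrite (mulnDl 2 2) !mulSn !mul0n !addn0; apply: leq_add;
  apply: leq_trans (cU _ _) _; exact: leq_add.
Qed.

Lemma sphere_add N C :
  (#|` fset_set (sphere n (N + C))| <= 4 ^ C * #|` fset_set (sphere n N)|)%N.
Proof.
elim: C => [|C IH]; first by rewrite addn0 mul1n.
rewrite addnS; apply: leq_trans (sphere_succ _) _.
by rewrite expnS -mulnA leq_mul2l.
Qed.

Lemma word_length_inv (g : BS n) : (word_length g^-1%g <= word_length g)%N.
Proof.
have [w <- <-] := word_lengthP g; rewrite -bs_classV.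
by apply: leq_trans (word_length_le _ _) _; rewrite size_rev size_map.
Qed.

(** A peak has k > 0, so the inverses of peaks are not peaks, and they lie on the
    same sphere. *)
Lemma peak_le_half N :
  (2 * #|` fset_set (peak_set `&` sphere n N)| <= #|` fset_set (sphere n N)|)%N.
Proof.
set X := fset_set (peak_set `&` _); pose Y := [fset g^-1 | g in X]%fset%g.
have XP g : (g \in X) = (g \in peak_set `&` sphere n N).
  by rewrite in_fset_set //; exact: finite_peak_sphere.
have cY : #|` Y| = #|` X| by apply: card_imfset; exact: invg_inj.
have disj : (X `&` Y)%fset = fset0.
  apply/fsetP => g; rewrite !inE; apply/negP => /andP[].
  rewrite XP inE => -[[p [u [_ E]]] _] /imfsetP[h /= + gh].
  rewrite XP inE => -[[p' [u' [_ E']]] _].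
  by move: E; rewrite gh (bs_affV hn) E' => -[]; lia.
have -> : (2 * #|` X| = #|` (X `|` Y)%fset|)%N.
  by have := cardfsUI X Y; rewrite disj cardfs0 cY; lia.
apply/fsubset_leq_card/fsubsetP => g; rewrite inE => /orP[|/imfsetP[h /= + ->]].
  by rewrite XP in_fset_set ?inE; [case | exact: finite_sphere].
rewrite XP in_fset_set ?inE; last exact: finite_sphere.
move=> -[_ hN]; rewrite /sphere /= -hN; apply/eqP.
by rewrite eqn_leq word_length_inv -{1}[h]invgK word_length_inv.
Qed.

Lemma sphere_gt0 N : (0 < #|` fset_set (sphere n N)|)%N.
Proof.
rewrite cardfs_gt0; apply/fset0Pn; exists (bs_t n ^+ N)%g.
rewrite in_fset_set ?inE; last exact: finite_sphere.
apply/eqP; rewrite eqn_leq; apply/andP; split.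
  have -> : (bs_t n ^+ N)%g = bs_class n (nseq N letter_t).
    by apply: (bs_aff_inj hn); rewrite (bs_aff_tX hn) (bs_aff_class hn) aff_word_nseq_t.
  by rewrite (leq_trans (word_length_le _ _)) ?size_nseq.
have [w <- wg] := word_lengthP (bs_t n ^+ N)%g.
have := word_digits hn w; rewrite -(bs_aff_class hn) wg (bs_aff_tX hn).
by move=> [m [M [ds [_ kB _ C _]]]]; lia.
Qed.

Lemma peak_positive_density (R : realType) : positive_density R peak_set.
Proof.
pose C := (uphalf n + 23)%N.
have C0 : (0 : R) < 4 ^+ C by rewrite exprn_gt0.
exists ((4 ^+ C)^-1 / 2); first by rewrite divr_gt0 ?invr_gt0.
exists C => N CN; rewrite -(subnK CN); set S := sphere n _.
have S0 : (0 : R) < #|` fset_set S|%:R by rewrite ltr0n sphere_gt0.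
have lo : (#|` fset_set S| <= 4 ^ C * #|` fset_set (peak_set `&` S)|)%N.
  by apply: leq_trans (sphere_add _ _) _; rewrite leq_mul2l sphere_le_peak orbT.
have up := peak_le_half (N - C + C).
have C1 : (4 ^+ C)^-1 < 1 :> R.
  by rewrite invf_lt1 // exprn_egt1 ?ltr1n // /C addnS.
apply/andP; split.
  rewrite ltr_pdivlMr // (lt_le_trans (y := (4 ^+ C)^-1 * #|` fset_set S|%:R)) //.
    by rewrite ltr_pM2r // ltr_pdivrMr // ltr_pMr ?invr_gt0 // ltr1n.
  by rewrite ler_pdivrMl // -natrX -natrM ler_nat.
rewrite ltr_pdivrMr //.
have : 2 * #|` fset_set (peak_set `&` S)|%:R <= #|` fset_set S|%:R :> R.
  by rewrite -natrM ler_nat.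
move: S0 C1; nra.
Qed.

End Density.

Theorem theorem5p15 (R : realType) (n : nat) (hn : (3 <= n)%N) :
  exists A : set (BS n),
    positive_density R A /\ (forall g : BS n, A g -> 0 < kappa R 1 g).
Proof.
exists (@peak_set n); split; first exact: peak_positive_density.
by move=> g [p [u gc]]; exact: kappa_peak_gt0 gc.
Qed.
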